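(* Let $G$ be a finite simple graph and $k$ a positive integer. If $r^*\in R_{\max}(G,k)$, then (i) $r^*$ is a proper restraint; and (ii) $A_7''(G,r^* )=\min\{A_7''(G,r): r \text{ is a proper } k\text{-restraint on } G\}$, where for a restraint $r$, $$A_7''(G,r)=-\sum_{u\in V(G)}\ \sum_{\{v,w\}\subseteq N_G(u),\ v\neq w}|r(v)\cap r(w)|$$ (inner sum over unordered pairs of distinct neighbours of $u$). Equivalently, $$\sum_{u\in V(G)}\sum_{v,w\in N_G(u),\ v\neq w}|r^*(v)\cap r^*(w)|\ \geq\ \sum_{u\in V(G)}\sum_{v,w\in N_G(u),\ v\neq w}|r(v)\cap r(w)|$$ for every proper $k$-restraint $r$ on $G$.
   Context: A restraint $r$ on a graph $G$ assigns to each vertex $v$ a finite set $r(v)\subset\mathbb{N}$ of forbidden colours; a proper $x$-colouring $c$ of $G$ is permitted by $r$ if $c(v)\notin r(v)$ for all $v$, and $\pi_r(G,x)$ denotes the number of proper $x$-colourings permitted by $r$. If $G$ has $n$ vertices, a $k$-restraint is a restraint with $|r(v)|=k$ and $r(v)\subseteq\{1,2,\dots,kn\}$ for every vertex $v$. A restraint is proper if $r(u)\cap r(v)=\emptyset$ for every edge $uv$. $N_G(u)$ is the set of neighbours of $u$. $R_{\max}(G,k)$ is the set of $k$-restraints $r$ on $G$ such that for every $k$-restraint $r'$ on $G$, $\pi_r(G,x)\geq\pi_{r'}(G,x)$ for all sufficiently large $x$. *)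

(* Defs.v *)
From HB Require Import structures.
From mathcomp Require Export all_boot all_order all_algebra.
From mathcomp Require Export finmap.

Set Implicit Arguments.
Unset Strict Implicit.
Unset Printing Implicit Defensive.

Import Order.TTheory GRing.Theory Num.Theory.
Local Open Scope ring_scope.

(* A finite simple graph is a symmetric irreflexive [adj : rel V] on a finite  *)
(* vertex type [V]; both properties are hypotheses of the theorems.            *)

Definition nbhd (V : finType) (adj : rel V) (u : V) : {set V} :=
  [set v | adj u v].

Definition restraint (V : finType) := V -> {fset nat}.

(* The colours are 1, ..., x: the ordinal [i : 'I_x] stands for colour [i.+1]. *)
Definition colour (x : nat) (i : 'I_x) : nat := i.+1.

Definition proper_colouring (V : finType) (adj : rel V) (x : nat)
    (c : {ffun V -> 'I_x}) : bool :=
  [forall u, forall v, adj u v ==> (c u != c v)].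

Definition permitted (V : finType) (r : restraint V) (x : nat)
    (c : {ffun V -> 'I_x}) : bool :=
  [forall v, colour (c v) \notin r v].

Definition restrained_count (V : finType) (adj : rel V) (r : restraint V)
    (x : nat) : nat :=
  #|[set c : {ffun V -> 'I_x} | proper_colouring adj c && permitted r c]|.

Definition is_k_restraint (V : finType) (k : nat) (r : restraint V) : Prop :=
  forall v : V, #|` r v| = k /\
    (forall a : nat, a \in r v -> (1 <= a <= k * #|V|)%N).

Definition proper_restraint (V : finType) (adj : rel V) (r : restraint V)
    : Prop :=
  forall u v : V, adj u v -> (r u `&` r v)%fset = fset0.

Definition Rmax (V : finType) (adj : rel V) (k : nat) (r : restraint V) : Prop :=
  is_k_restraint k r /\
  forall r' : restraint V, is_k_restraint k r' ->
    exists x0 : nat, forall x : nat, (x0 <= x)%N ->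
      (restrained_count adj r' x <= restrained_count adj r x)%N.

(* Each unordered pair of distinct neighbours is counted once, as the ordered  *)
(* pair (v, w) with v before w in the enumeration of [V].                      *)
Definition A7'' (V : finType) (adj : rel V) (r : restraint V) : int :=
  - \sum_(u : V) \sum_(v in nbhd adj u)
      \sum_(w in nbhd adj u | (enum_rank v < enum_rank w)%N)
        (#|` (r v `&` r w)%fset|)%:Z.

Definition is_minimum (S : int -> Prop) (m : int) : Prop :=
  S m /\ forall y : int, S y -> m <= y.

Definition common_sum (V : finType) (adj : rel V) (r : restraint V) : nat :=
  (\sum_(u : V) \sum_(v in nbhd adj u) \sum_(w in nbhd adj u | v != w)
     #|` (r v `&` r w)%fset|)%N.

(* Main.v *)
(** Compare the permitted proper colourings of two k-restraints as x grows,
    with n = #|V|.  Let m be the number of ordered monochromatic edges of a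
    colouring c and t the number of its ordered monochromatic triangles.  Then
    2 [c proper] = 2 - m unless c takes at most n - 2 colours, and
    24 [c proper] = 24 - 18 m + 3 m^2 - 4 t unless c takes at most n - 3
    colours.  The error of such an identity does not depend on the restraint,
    so its sum over permitted colourings changes with the restraint only
    through the non-permitted ones; a non-permitted colouring has one forced
    colour, and hence those using at most n - j colours are O(x^(n - j - 1)).
    The sums of m, m^2 and t over permitted colourings are explicit.  The first
    identity yields the coefficient of x^(n - 2), in which the restraint enters
    through - sum_(uv edge) |r u cap r v|; the second one yields, for proper
    restraints, the coefficient of x^(n - 3), in which it enters through
    [common_sum]. *)
Require Import Defs.
From mathcomp Require Import all_boot all_order all_algebra finmap zify ring.

Set Implicit Arguments.
Unset Strict Implicit.
Unset Printing Implicit Defensive.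

Import Order.TTheory GRing.Theory Num.Theory.

(** * Finite sums and truncated subtraction *)

Lemma sum_Posz (I : finType) (P : pred I) (F : I -> nat) :
  (\sum_(i | P i) (F i)%:Z = (\sum_(i | P i) F i)%N%:Z)%R.
Proof. by rewrite -[RHS]intz sumMz; apply: eq_bigr => i _; rewrite intz. Qed.

Lemma sum_support (I : finType) (F : I -> nat) (l : seq I) : uniq l ->
  (forall i, F i != 0 -> i \in l) -> \sum_i F i = \sum_(i <- l) F i.
Proof.
move=> ul Fl; rewrite [RHS](big_uniq _ ul) /= [RHS]big_mkcond; apply: eq_bigr => i _.
by case: ifPn => // /(contraNN (Fl i))/negPn/eqP.
Qed.

Lemma sum_andb_card (T : finType) (P Q : pred T) (b : bool) :
  \sum_(c | P c) (b && Q c) = b * #|[set c | P c & Q c]|.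
Proof.
case: b => /=; last by rewrite big1.
rewrite mul1n -sum1_card -big_mkcondr /=.
by apply: eq_bigl => c; rewrite inE.
Qed.

(** Used with a the size of a union of forbidden sets and b the size of an intersection: it isolates
    the part x - m that does not depend on the restraint. *)
Lemma subn_split (x a b m : nat) : a + b = m -> m <= x -> x - a = x - m + b.
Proof. by lia. Qed.

(** * Coinciding vertices of a colouring that uses almost as many colours as there are vertices *)

Section Kernels.
Variables (V T : finType) (c : {ffun V -> T}).

(** Each colour seen on [S] is also seen outside [S], so the complement of [S] already has the full
    image. *)
Lemma card_image_redundant (S : {set V}) :
  (forall s, s \in S -> exists2 t, t \notin S & c t = c s) ->
  #|c @: V| + #|S| <= #|V|.
Proof.
move=> H.
have /subset_leq_card le1 : c @: V \subset c @: ~: S.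
  apply/subsetP=> _ /imsetP[v _ ->].
  have [/H[t tS <-]|vS] := boolP (v \in S); apply: imset_f; first by rewrite inE.
  by rewrite inE.
have := leq_imset_card c (~: S); have := cardsC S.
by lia.
Qed.

(** At most one vertex can be redundant, and the pair u, v already accounts for it. *)
Lemma kernel_pair (u v : V) : u != v -> c u = c v -> #|V| < #|c @: V| + 2 ->
  forall x y, x != y -> c x = c y -> (x, y) \in [:: (u, v); (v, u)].
Proof.
move=> uv cuv lt.
have in_uv x y : x != y -> c x = c y -> (y == u) || (y == v).
  move=> xy cxy; apply/negPn/negP; rewrite negb_or => /andP[yu yv].
  (* A coincidence x, y with y outside the pair makes both u and y redundant: v represents u, and x
     represents y unless x = u, when v does. *)
  have /card_image_redundant : forall s, s \in [set u; y] ->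
      exists2 t, t \notin [set u; y] & c t = c s.
    move=> s /set2P[]->.
      by exists v => //; rewrite !inE negb_or eq_sym uv eq_sym.
    have [xu|xu] := eqVneq x u.
      by exists v; [rewrite !inE negb_or eq_sym uv eq_sym|rewrite -cxy xu].
    by exists x => //; rewrite !inE negb_or xu.
  by rewrite cards2 eq_sym yu; lia.
move=> x y xy cxy; have := in_uv _ _ xy cxy.
have := in_uv y x; rewrite eq_sym => /(_ xy (esym cxy)).
move: xy; rewrite !inE !xpair_eqE.
by move=> xy /orP[]/eqP ex /orP[]/eqP ey; subst; rewrite ?eqxx ?orbT //;
   move: xy; rewrite ?eqxx.
Qed.

(** The class of u, v, s uses up both redundant vertices; a coincidence reaching a further vertex y
    would make u, s and y redundant. *)
Lemma kernel_triple (u v s : V) : u != v -> s != u -> s != v ->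
  c u = c v -> c s = c u -> #|V| < #|c @: V| + 3 ->
  forall x y, x != y -> c x = c y ->
    (x \in [:: u; v; s]) && (y \in [:: u; v; s]).
Proof.
move=> uv su sv cuv csu lt.
have in_uvs x y : x != y -> c x = c y -> y \in [:: u; v; s].
  move=> xy cxy; apply/negPn/negP; rewrite !inE !negb_or => /and3P[yu yv ys].
  have vS : v \notin [set u; s; y].
    by rewrite !inE !negb_or eq_sym uv eq_sym sv eq_sym yv.
  have /card_image_redundant : forall z, z \in [set u; s; y] ->
      exists2 t, t \notin [set u; s; y] & c t = c z.
    move=> z; rewrite !inE -orbA => /or3P[]/eqP->; [by exists v|by exists v; rewrite ?csu|].
    have [xS|xS] := boolP (x \in [set u; s]).
      by exists v => //; rewrite -cxy; case/set2P: xS => ->; rewrite ?csu.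
    by exists x => //; rewrite in_setU negb_or xS inE.
  rewrite -setUA cardsU1 cards2 !inE negb_or eq_sym su eq_sym yu eq_sym ys.
  by rewrite leqNgt lt.
move=> x y xy cxy; rewrite (in_uvs x y xy cxy) andbT.
by apply: (in_uvs y x); rewrite 1?eq_sym // cxy.
Qed.

(** One redundant vertex is spent on each pair. A further vertex y in a coincidence would make u, s,
    y redundant, and [csu] rules out coincidences between the two pairs. *)
Lemma kernel_two_pairs (u v s t : V) : u != v -> s != t ->
  c u = c v -> c s = c t -> c s != c u -> #|V| < #|c @: V| + 3 ->
  forall x y, x != y -> c x = c y ->
    (x, y) \in [:: (u, v); (v, u); (s, t); (t, s)].
Proof.
move=> uv st cuv cst csu lt.
have neq a b : c a = c u -> c b = c s -> b != a.
  by move=> ca cb; apply: contraNneq csu => eba; rewrite -cb -ca eba.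
have in_uvst x y : x != y -> c x = c y -> y \in [:: u; v; s; t].
  move=> xy cxy; apply/negPn/negP; rewrite !inE !negb_or => /and4P[yu yv ys yt].
  have vS : v \notin [set u; s; y].
    by rewrite !inE !negb_or eq_sym uv eq_sym neq //= eq_sym.
  have tS : t \notin [set u; s; y].
    by rewrite !inE !negb_or neq //= eq_sym st eq_sym.
  have /card_image_redundant : forall z, z \in [set u; s; y] ->
      exists2 t, t \notin [set u; s; y] & c t = c z.
    move=> z; rewrite !inE -orbA => /or3P[]/eqP->; [by exists v|by exists t|].
    have [xu|xu] := eqVneq x u; first by exists v; rewrite // -cxy xu.
    have [xs|xs] := eqVneq x s; first by exists t; rewrite // -cxy xs.
    by exists x; rewrite // !inE !negb_or xu xs.
  rewrite -setUA cardsU1 cards2 !inE negb_or eq_sym neq // eq_sym yu eq_sym ys.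
  by rewrite leqNgt lt.
move=> x y xy cxy; have := in_uvst x y xy cxy.
have := in_uvst y x; rewrite eq_sym => /(_ xy (esym cxy)).
have nuv : v != u by rewrite eq_sym.
rewrite !inE !xpair_eqE => /or4P[]/eqP ex /or4P[]/eqP ey; subst;
  rewrite ?eqxx ?orbT //; move: xy cxy csu; rewrite ?eqxx //;
  by move=> _ cxy /eqP[]; congruence.
Qed.

End Kernels.

(** * Exact numbers of permitted colourings with prescribed coincidences *)

Section Counts.

Definition bounded_fset (x : nat) (s : {fset nat}) :=
  forall a, a \in s -> 1 <= a <= x.

Lemma bounded_fsetU x s t :
  bounded_fset x s -> bounded_fset x t -> bounded_fset x (s `|` t)%fset.
Proof. by move=> bs bt a; rewrite in_fsetU => /orP[/bs|/bt]. Qed.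

Lemma card_forbidden x (s : {fset nat}) : bounded_fset x s ->
  #|[pred i : 'I_x | colour i \in s]| = #|` s|.
Proof.
move=> bs; rewrite cardE -(size_map (@colour x)).
apply/perm_size/uniq_perm => //.
- rewrite map_inj_uniq ?enum_uniq // => i j; rewrite /colour => -[].
  exact: val_inj.
- exact: fset_uniq.
move=> a; apply/mapP/idP => [[i]|sa]; first by rewrite mem_enum inE => ? ->.
have /andP[a1 ax] := bs a sa.
have lt : a.-1 < x by lia.
have E : colour (Ordinal lt) = a by rewrite /colour /=; lia.
by exists (Ordinal lt); rewrite // mem_enum inE E.
Qed.

Lemma card_allowed x (s : {fset nat}) : bounded_fset x s ->
  #|[pred i : 'I_x | colour i \notin s]| = x - #|` s|.
Proof.
move=> bs; rewrite -(card_forbidden bs) -[X in X - _]card_ord.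
by rewrite -(cardC [pred i : 'I_x | colour i \in s]) addKn; apply: eq_card.
Qed.

Variables (V : finType) (k : nat) (r : restraint V) (x : nat).
Hypothesis kr : is_k_restraint k r.
Hypothesis xge : k * #|V| <= x.

Let br v : bounded_fset x (r v).
Proof. by move=> a /(proj2 (kr v)); lia. Qed.

(** Vertices are coloured independently: one choice or none on [S], according to whether the
    prescribed colour is allowed, and x - k choices elsewhere. *)
Lemma card_permitted_prescribed (S : {set V}) (f : V -> 'I_x) :
  #|[set c : {ffun V -> 'I_x} | permitted r c & [forall w in S, c w == f w]]| =
  [forall w in S, colour (f w) \notin r w] * (x - k) ^ (#|V| - #|S|).
Proof.
pose F w := [pred i : 'I_x |
  (colour i \notin r w) && ((w \in S) ==> (i == f w))].
transitivity #|family F|.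
  apply: eq_card => c; rewrite !inE; apply/andP/familyP => [[/forallP pc /forallP fc] w|H].
    by rewrite inE pc fc.
  by split; apply/forallP => w; have := H w; rewrite inE => /andP[].
rewrite card_family foldrE big_map big_enum /=.
rewrite (bigID (mem S)) /=; congr (_ * _).
  have E w : w \in S -> #|F w| = (colour (f w) \notin r w).
    move=> wS; case: (boolP (colour _ \notin _)) => fw.
      rewrite -[RHS](card1 (f w)); apply: eq_card => i.
      by rewrite !inE wS /=; case: eqVneq => [->|]; rewrite ?fw // andbF.
    apply: eq_card0 => i; rewrite !inE wS /=.
    by case: eqVneq => [->|]; rewrite ?(negbTE fw) // andbF.
  rewrite (eq_bigr (fun w => nat_of_bool (colour (f w) \notin r w))) //.
  case: forall_inP => [H|H].
    by rewrite big1 // => w /H ->.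
  have /forall_inPn[w wS nw] : ~~ [forall w in S, colour (f w) \notin r w].
    by apply/forall_inP.
  by rewrite (bigD1 w) //= (negbTE nw).
rewrite (eq_bigr (fun=> x - k)) => [|w wS].
  rewrite prod_nat_const -(cardsC S) addKn; congr (_ ^ _).
  by apply: eq_card => w; rewrite !inE.
rewrite -(proj1 (kr w)) -(card_allowed (@br w)).
by apply: eq_card => i; rewrite !inE (negbTE wS) /= [LHS]andbT.
Qed.

Lemma card_permitted :
  #|[set c : {ffun V -> 'I_x} | permitted r c]| = (x - k) ^ #|V|.
Proof.
pose F w := [pred i : 'I_x | colour i \notin r w].
transitivity #|family F|.
  by apply: eq_card => c; rewrite inE; apply/forallP/familyP.
rewrite card_family foldrE big_map big_enum /= -prod_nat_const.
by apply: eq_bigr => w _; rewrite card_allowed // (proj1 (kr w)).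
Qed.

(** Colourings are sorted by the common colour on [S], which may be any colour outside [s], the
    union of the forbidden sets over [S]. *)
Lemma card_permitted_mono (u : V) (S : {set V}) (s : {fset nat}) :
  u \in S -> bounded_fset x s ->
  (forall a, (a \in s) = [exists w in S, a \in r w]) ->
  #|[set c : {ffun V -> 'I_x} | permitted r c & [forall w in S, c w == c u]]| =
  (x - #|` s|) * (x - k) ^ (#|V| - #|S|).
Proof.
move=> uS bs sE.
rewrite -sum1_card (partition_big (fun c : {ffun V -> 'I_x} => c u) predT) //=.
have E a : \sum_(c : {ffun V -> 'I_x} | (c \in [set c0 | permitted r c0 &
    [forall w in S, c0 w == c0 u]]) && (c u == a)) 1 =
    (colour a \notin s) * (x - k) ^ (#|V| - #|S|).
  rewrite sum1dep_card.
  have -> : (colour a \notin s) = [forall w in S, colour a \notin r w].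
    rewrite sE negb_exists; apply: eq_forallb => w.
    by rewrite negb_and -implybE.
  rewrite -(card_permitted_prescribed S (fun=> a)); apply: eq_card => c.
  rewrite !inE -andbA; congr (_ && _).
  apply/andP/forall_inP => [[/forall_inP H /eqP <-] //|H].
  rewrite -(eqP (H u uS)) eqxx; split=> //.
  by apply/forall_inP=> w /H/eqP->; rewrite (eqP (H u uS)).
rewrite (eq_bigr _ (fun a _ => E a)) -big_distrl /=; congr (_ * _).
rewrite -card_allowed // -sum1_card [RHS]big_mkcond.
by apply: eq_bigr => a; rewrite inE; case: ifP.
Qed.

Lemma card_permitted_pair (u v : V) : u != v ->
  #|[set c : {ffun V -> 'I_x} | permitted r c & c u == c v]| =
  (x - #|` (r u `|` r v)%fset|) * (x - k) ^ (#|V| - 2).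
Proof.
move=> uv; have -> : 2 = #|[set u; v]| by rewrite cards2 uv.
rewrite -(@card_permitted_mono u); first last.
- move=> a; rewrite in_fsetU; apply/orP/exists_inP => [[]au|[w]].
  + by exists u; rewrite // set21.
  + by exists v; rewrite // set22.
  + by case/set2P=> ->; [left|right].
- exact: bounded_fsetU.
- by rewrite set21.
apply: eq_card => c; rewrite !inE; congr (_ && _).
apply/eqP/forall_inP => [cuv w|H]; last by rewrite (eqP (H v _)) // set22.
by case/set2P=> ->; rewrite ?cuv.
Qed.

Lemma card_permitted_triple (u v w : V) : u != v -> u != w -> v != w ->
  #|[set c : {ffun V -> 'I_x} | permitted r c & (c u == c v) && (c u == c w)]| =
  (x - #|` (r u `|` (r v `|` r w))%fset|) * (x - k) ^ (#|V| - 3).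
Proof.
move=> uv uw vw; have -> : 3 = #|u |: [set v; w]|.
  by rewrite cardsU1 cards2 vw !inE negb_or uv uw.
rewrite -(@card_permitted_mono u); first last.
- move=> a; rewrite !in_fsetU; apply/or3P/exists_inP => [[]au|[z]].
  + by exists u; rewrite // !inE eqxx.
  + by exists v; rewrite // !inE eqxx orbT.
  + by exists w; rewrite // !inE eqxx !orbT.
  + by rewrite !inE => /or3P[]/eqP->; [constructor 1|constructor 2|constructor 3].
- by do 2?apply: bounded_fsetU.
- by rewrite !inE eqxx.
apply: eq_card => c; rewrite !inE; congr (_ && _).
apply/andP/forall_inP => [[/eqP cv /eqP cw] z|H].
  by rewrite !inE => /or3P[]/eqP->; rewrite -?cv -?cw.
by split; rewrite eq_sym H // !inE eqxx ?orbT.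
Qed.

(** Sorting by the colours of u and s leaves four prescribed vertices; the two colours are chosen
    independently, each avoiding the union over its own pair. *)
Lemma card_permitted_two_pairs (u v s t : V) : u != v -> s != t ->
  s \notin [:: u; v] -> t \notin [:: u; v] ->
  #|[set c : {ffun V -> 'I_x} | permitted r c & (c u == c v) && (c s == c t)]| =
  (x - #|` (r u `|` r v)%fset|) * (x - #|` (r s `|` r t)%fset|)
    * (x - k) ^ (#|V| - 4).
Proof.
rewrite !inE !negb_or => uv st /andP[su sv] /andP[tu tv].
pose S := u |: (v |: [set s; t]).
have cS : #|S| = 4.
  by rewrite !cardsU1 cards1 !inE !negb_or st uv !(eq_sym u) !(eq_sym v) su sv tu tv.
rewrite -sum1_card.
rewrite (partition_big (fun c : {ffun V -> 'I_x} => (c u, c s)) predT) //=.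
have E p : \sum_(c : {ffun V -> 'I_x} | (c \in [set c0 | permitted r c0 &
    (c0 u == c0 v) && (c0 s == c0 t)]) && ((c u, c s) == p)) 1 =
    (colour p.1 \notin (r u `|` r v)%fset) * (colour p.2 \notin (r s `|` r t)%fset)
     * (x - k) ^ (#|V| - 4).
  rewrite sum1dep_card; case: p => a b /=.
  pose f w := if w \in [:: u; v] then a else b.
  have fu : f u = a by rewrite /f !inE eqxx.
  have fv : f v = a by rewrite /f !inE eqxx orbT.
  have fs : f s = b by rewrite /f !inE (negbTE su) (negbTE sv).
  have ft : f t = b by rewrite /f !inE (negbTE tu) (negbTE tv).
  have allS (P : pred V) : [forall w in S, P w] = [&& P u, P v, P s & P t].
    apply/forall_inP/and4P => [H|[Pu Pv Ps Pt] w].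
      by split; apply: H; rewrite !inE eqxx ?orbT.
    by rewrite !inE => /or4P[]/eqP->.
  have := card_permitted_prescribed S f; rewrite !allS cS fu fv fs ft => H.
  rewrite !in_fsetU !negb_or mulnb -andbA -H; apply: eq_card => c.
  rewrite !inE allS fu fv fs ft xpair_eqE -andbA; congr (_ && _).
  apply/andP/and4P => [[/andP[/eqP<- /eqP<-] /andP[-> ->]] //|].
  by case=> /eqP-> /eqP-> /eqP-> /eqP->; rewrite !eqxx.
rewrite (eq_bigr _ (fun a _ => E a)) -big_distrl /=; congr (_ * _).
rewrite -!card_allowed; try exact: bounded_fsetU.
rewrite -!sum1_card big_distrlr /= [RHS]pair_big /= [RHS]big_mkcond.
by apply: eq_bigr => a _; rewrite !inE; do 2 case: (~~ _).
Qed.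

End Counts.

(** * Bounds on the number of colourings with few colours *)

Section Remainder.
Variable V : finType.

(** With n vertices and the colour [a] forced, at most n - j - 1 other colours remain to be chosen,
    so there are O(x^(n - j - 1)) such colourings. *)
Lemma card_small_image_at (x j : nat) (v : V) (a : 'I_x) :
  #|[set c : {ffun V -> 'I_x} | #|c @: V| + j <= #|V| & c v == a]| * x ^ j.+1
    <= #|V| ^ #|V| * x ^ #|V|.
Proof.
set n := #|V|; set A := [set _ | _ & _].
have [->|[c0 c0A]] := set_0Vmem A; first by rewrite cards0.
have im_gt0 (c : {ffun V -> 'I_x}) : 0 < #|c @: V|.
  by apply/card_gt0P; exists (c v); apply: imset_f.
have jn : j < n by move: c0A; rewrite inE => /andP[]; have := im_gt0 c0; lia.
pose p := n - j.+1.
(* Such a colouring factors through [option 'I_p], with [None] coloured [a]. *)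
pose F (st : {ffun V -> option 'I_p} * {ffun 'I_p -> 'I_x}) : {ffun V -> 'I_x} :=
  [ffun w => odflt a (omap st.2 (st.1 w))].
have /subset_leq_card le : A \subset F @: predT.
  apply/subsetP => c; rewrite inE => /andP[imc /eqP cva].
  pose l := enum (c @: V :\ a).
  have sl : size l <= p.
    rewrite -cardE; have := cardsD1 a (c @: V).
    have -> : a \in c @: V by rewrite -cva imset_f.
    by move=> E; move: imc; rewrite E /p -/n; clear; lia.
  apply/imsetP; exists ([ffun w => insub (index (c w) l)], [ffun i : 'I_p => nth a l i]) => //.
  apply/ffunP => w; rewrite !ffunE /=.
  have [cw|cw] := eqVneq (c w) a.
    (* A vertex coloured [a] has an index past the end of [l]: either [insub] gives [None], or [nth]
       returns its default; both yield [a]. *)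
    case: insubP => [i _ vi|_] //=; rewrite ffunE vi nth_default //.
    by rewrite memNindex // mem_enum cw !inE eqxx.
  have cl : c w \in l by rewrite mem_enum !inE cw imset_f.
  have lt : index (c w) l < p by apply: leq_trans sl; rewrite index_mem.
  by rewrite (insubT (fun i => i < p) lt) /= ffunE /= nth_index.
apply: leq_trans (leq_mul (leq_trans le (leq_imset_card _ _)) (leqnn _)) _.
(* There are (p + 1)^n x^p pairs of maps, where p + (j + 1) = n and p + 1 <= n. *)
rewrite card_prod !card_ffun card_option !card_ord -mulnA -expnD /p subnK //.
by apply: leq_mul => //; rewrite leq_exp2r ?subnSK ?leq_subr //; apply: leq_ltn_trans jn.
Qed.

(** A union bound over the n k pairs of a vertex and a colour forbidden there, one of which the
    colouring must realise. *)
Lemma card_small_image_not_permitted (k : nat) (r : restraint V) (x j : nat) :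
  is_k_restraint k r -> k * #|V| <= x ->
  #|[set c : {ffun V -> 'I_x} | #|c @: V| + j <= #|V| & ~~ permitted r c]|
     * x ^ j.+1 <= #|V| * k * #|V| ^ #|V| * x ^ #|V|.
Proof.
move=> kr xge; set A := [set _ | _ & _].
pose B v a := [set c : {ffun V -> 'I_x} | #|c @: V| + j <= #|V| & c v == a].
have le : #|A| <= \sum_v \sum_(a : 'I_x | colour a \in r v) #|B v a|.
  have -> : \sum_v \sum_(a : 'I_x | colour a \in r v) #|B v a| =
      \sum_c \sum_v \sum_(a : 'I_x | colour a \in r v) (c \in B v a).
    rewrite exchange_big; apply: eq_bigr => v _; rewrite exchange_big.
    by apply: eq_bigr => a _; rewrite -sum1_card big_mkcond; apply: eq_bigr => c; case: ifP.
  rewrite -sum1_card big_mkcond /=; apply: leq_sum => c _.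
  case: ifP => // /[!inE] /andP[imc /forallPn[v /negPn cv]].
  by rewrite (bigD1 v) //= (bigD1 (c v)) //= !inE imc eqxx.
apply: leq_trans (leq_mul le (leqnn _)) _.
rewrite -mulnA -mulnA -sum_nat_const big_distrl /=; apply: leq_sum => v _.
have <- : \sum_(a : 'I_x | colour a \in r v) 1 = k.
  rewrite sum1_card -(proj1 (kr v)); apply: card_forbidden => a /(proj2 (kr v)).
  by lia.
rewrite !big_distrl /=; apply: leq_sum => a _; rewrite mul1n.
exact: card_small_image_at.
Qed.


End Remainder.

(** * Comparison of two restraints through a leading term *)

Section Comparison.
Variables (V : finType) (adj : rel V) (k : nat).
Local Open Scope ring_scope.

Lemma sum_not_permitted_bound (r : restraint V) (x j C : nat)
    (R : {ffun V -> 'I_x} -> int) :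
  is_k_restraint k r -> (k * #|V| <= x)%N -> (forall c, `|R c| <= C%:Z) ->
  (forall c, R c != 0 -> (#|c @: V| + j <= #|V|)%N) ->
  `|\sum_(c | ~~ permitted r c) R c| * (x ^ j.+1)%N%:Z
     <= (C * (#|V| * k * #|V| ^ #|V| * x ^ #|V|))%N%:Z.
Proof.
move=> kr xge RC Rj.
pose A := [set c : {ffun V -> 'I_x} | (#|c @: V| + j <= #|V|)%N & ~~ permitted r c].
have le : `|\sum_(c | ~~ permitted r c) R c| <= (C * #|A|)%N%:Z.
  apply: le_trans (ler_norm_sum _ _ _) _.
  apply: (@le_trans _ _ (\sum_(c in A) C%:Z)); last first.
    by rewrite sumr_const PoszM pmulrn mulrzz.
  rewrite big_mkcond [leRHS]big_mkcond; apply: ler_sum => c _.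
  case: ifP => nc; last by case: ifP.
  rewrite inE nc andbT; case: ifP => // /negbT imc.
  have [->|/Rj] := eqVneq (R c) 0; first by rewrite normr0.
  by rewrite (negbTE imc).
apply: (@le_trans _ _ ((C * #|A|)%N%:Z * (x ^ j.+1)%N%:Z)).
  by apply: ler_wpM2r.
rewrite -PoszM lez_nat -mulnA leq_mul2l.
by rewrite (card_small_image_not_permitted j kr xge) orbT.
Qed.

Lemma restrained_count_sum (r : restraint V) (x D : nat) :
  (D * restrained_count adj r x)%N%:Z =
  \sum_(c : {ffun V -> 'I_x} | permitted r c) (D * proper_colouring adj c)%N%:Z.
Proof.
rewrite PoszM /restrained_count -sum1_card -sum_Posz mulr_sumr.
rewrite (eq_bigl (fun c : {ffun V -> 'I_x} => permitted r c && proper_colouring adj c)).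
  rewrite big_mkcondr /=; apply: eq_bigr => c _.
  by case: ifP; rewrite ?mulr1 ?muln1 ?muln0.
by move=> c; rewrite inE andbC.
Qed.

(** Here g replaces D times the indicator of properness, with a bounded error confined to colourings
    with at most n - j colours. The resulting error in the difference of counts is O(x^(n - j - 1)),
    too small to offset K (x - k)^(n - j) with K > 0. *)
Lemma leading_term_le (r r' : restraint V) (j D K C x0 x1 : nat)
    (g : forall x, {ffun V -> 'I_x} -> int) :
  is_k_restraint k r -> is_k_restraint k r' -> (j <= #|V|)%N ->
  (forall x (c : {ffun V -> 'I_x}),
     `|(D * proper_colouring adj c)%N%:Z - g x c| <= C%:Z) ->
  (forall x (c : {ffun V -> 'I_x}), (#|V| < #|c @: V| + j)%N ->
     (D * proper_colouring adj c)%N%:Z = g x c) ->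
  (forall x, (x1 <= x)%N ->
     \sum_(c | permitted r c) g x c =
     \sum_(c | permitted r' c) g x c + (K * (x - k) ^ (#|V| - j))%N%:Z) ->
  (forall x, (x0 <= x)%N ->
     (restrained_count adj r x <= restrained_count adj r' x)%N) ->
  K = 0%N.
Proof.
move=> kr kr' jn gC gj gK cnt; apply/eqP/negPn/negP; rewrite -lt0n => K0.
set n := #|V| in jn gj gK *.
pose B := (2 * (C * (n * k * n ^ n)))%N.
(* Large enough for both asymptotic hypotheses, for all forbidden colours to be at most x, for x <=
   2 (x - k), and to exceed B 2^n at the end. *)
pose x := (x0 + x1 + k * n + 2 * k + B * 2 ^ n).+1.
pose R (c : {ffun V -> 'I_x}) := (D * proper_colouring adj c)%N%:Z - g x c.
have Rj c : R c != 0 -> (#|c @: V| + j <= #|V|)%N.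
  by apply: contraR; rewrite -ltnNge /R => /gj ->; rewrite subrr.
have xge : (k * n <= x)%N by rewrite /x; lia.
have b1 := sum_not_permitted_bound kr xge (@gC x) Rj.
have b2 := sum_not_permitted_bound kr' xge (@gC x) Rj.
(* The total error over all colourings is the same for both restraints and cancels, leaving only the
   errors on non-permitted colourings. *)
have split s : (D * restrained_count adj s x)%N%:Z =
    \sum_(c | permitted s c) g x c + (\sum_c R c - \sum_(c | ~~ permitted s c) R c).
  rewrite (bigID (fun c => permitted s c) predT) /= addrK -big_split /=.
  by rewrite restrained_count_sum; apply: eq_bigr => c _; rewrite /R addrCA subrr addr0.
have le : (D * restrained_count adj r x)%N%:Z <= (D * restrained_count adj r' x)%N%:Z.
  by rewrite lez_nat leq_mul2l cnt ?orbT // /x; lia.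
move: le; rewrite !split gK; last by rewrite /x; lia.
move: b1 b2; set s1 := \sum_(c | ~~ permitted r c) R c.
set s2 := \sum_(c | ~~ permitted r' c) R c; rewrite -/n => b1 b2 le.
have {}le : (K * (x - k) ^ (n - j))%N%:Z <= `|s1| + `|s2|.
  by have := ler_norm s1; have := ler_norm (- s2); rewrite normrN; lia.
have : (K * (x - k) ^ (n - j) * x ^ j.+1 <= B * x ^ n)%N.
  rewrite -lez_nat PoszM; apply: (@le_trans _ _ ((`|s1| + `|s2|) * (x ^ j.+1)%N%:Z)).
    exact: ler_wpM2r.
  rewrite mulrDl; apply: le_trans (lerD b1 b2) _.
  by rewrite -PoszD lez_nat /B !mulnA; lia.
(* With [h2], the two sides become multiples of (x - k)^n, and cancelling it gives x <= B 2^n,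
   against the choice of x. *)
have h1 : (x * (x - k) ^ n <= K * (x - k) ^ (n - j) * x ^ j.+1)%N.
  rewrite -{1}(subnK jn) expnD expnS.
  have : ((x - k) ^ j <= x ^ j)%N.
    by case: j {jn gj gK Rj b1 b2 le} => // j; rewrite leq_exp2r // leq_subr.
  by move=> le_j; rewrite mulnCA; apply: leq_mul; [apply: leq_pmull|apply: leq_mul].
have h2 : (x ^ n <= 2 ^ n * (x - k) ^ n)%N.
  rewrite -expnMn; case: (n) => // m; rewrite leq_exp2r //; rewrite /x; lia.
move=> h3.
have : (x * (x - k) ^ n <= B * 2 ^ n * (x - k) ^ n)%N.
  apply: leq_trans h1 (leq_trans h3 _); rewrite -mulnA leq_mul2l h2 orbT //.
rewrite leq_pmul2r; last by rewrite expn_gt0; apply/orP; left; rewrite /x; lia.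
by rewrite /x; lia.
Qed.
End Comparison.

(** * Monochromatic edges, triangles, paths and matchings of one colouring *)

Section Statistics.
Variables (V T : finType) (adj : rel V) (c : {ffun V -> T}).
Hypotheses (adj_sym : symmetric adj) (adj_irr : irreflexive adj).

Definition mono (u v : V) : bool := adj u v && (c u == c v).

(** All statistics count ordered configurations: an edge counts twice, a triangle six times. *)
Definition mono_edges : nat := \sum_u \sum_v mono u v.

Definition mono_triangles : nat :=
  \sum_u \sum_v \sum_w [&& mono u v, mono u w & mono v w].

(** Two-edge paths with centre u and ordered distinct ends; the ends may themselves be adjacent. *)
Definition mono_paths : nat :=
  \sum_u \sum_v \sum_w [&& mono u v, mono u w & v != w].

Definition mono_matchings : nat :=
  \sum_u \sum_v \sum_s \sum_t
    [&& mono u v, mono s t, s \notin [:: u; v] & t \notin [:: u; v]].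

Lemma mono_sym : symmetric mono.
Proof. by move=> u v; rewrite /mono adj_sym eq_sym. Qed.

Lemma mono_neq u v : mono u v -> u != v.
Proof. by case/andP=> uv _; apply: contraTneq uv => ->; rewrite adj_irr. Qed.

Lemma mono_eq u v : mono u v -> c u = c v.
Proof. by case/andP=> _ /eqP. Qed.

Lemma mono_edges_eq0 :
  (mono_edges == 0) = [forall u, forall v, adj u v ==> (c u != c v)].
Proof.
rewrite /mono_edges sum_nat_eq0; apply: eq_forallb => u /=.
rewrite sum_nat_eq0; apply: eq_forallb => v /=; rewrite eqb0 /mono.
by rewrite negb_and implybE.
Qed.

Lemma mono_edges_le : mono_edges <= #|V| ^ 2.
Proof.
rewrite expnS expn1 -sum_nat_const; apply: leq_sum => u _.
by rewrite -sum1_card; apply: leq_sum => v _; apply: leq_b1.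
Qed.

Lemma mono_triangles_le : mono_triangles <= #|V| ^ 3.
Proof.
rewrite 2!expnS expn1 -sum_nat_const; apply: leq_sum => u _.
rewrite -sum_nat_const; apply: leq_sum => v _.
by rewrite -sum1_card; apply: leq_sum => w _; apply: leq_b1.
Qed.

Lemma sum_mono_edges (l : seq (V * V)) : uniq l ->
  (forall u v, mono u v -> (u, v) \in l) ->
  mono_edges = \sum_(e <- l) mono e.1 e.2.
Proof.
move=> ul H; rewrite /mono_edges pair_big /=.
by apply: sum_support => // -[u v] /=; rewrite eqb0 negbK; apply: H.
Qed.

Lemma sum_mono_triangles (l : seq (V * V * V)) : uniq l ->
  (forall u v w, mono u v -> mono u w -> mono v w -> (u, v, w) \in l) ->
  mono_triangles = \sum_(e <- l) [&& mono e.1.1 e.1.2, mono e.1.1 e.2 & mono e.1.2 e.2].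
Proof.
move=> ul H; rewrite /mono_triangles pair_big /= pair_big /=.
apply: sum_support => // -[[u v] w] /=.
by rewrite eqb0 negbK => /and3P[]; apply: H.
Qed.

Lemma mono_edges_injective : injective c -> mono_edges = 0.
Proof.
move=> ic; rewrite (@sum_mono_edges [::]) ?big_nil // => u v uv.
by have := mono_neq uv; rewrite (ic _ _ (mono_eq uv)) eqxx.
Qed.

Lemma mono_triangles_injective : injective c -> mono_triangles = 0.
Proof.
move=> ic; rewrite (@sum_mono_triangles [::]) ?big_nil // => u v w uv.
by have := mono_neq uv; rewrite (ic _ _ (mono_eq uv)) eqxx.
Qed.

(** At most one pair of vertices coincides, so the number of ordered monochromatic edges is 0 or
    2. *)
Lemma mono_edges_first_order : #|V| < #|c @: V| + 2 ->
  2 * (mono_edges == 0) + mono_edges = 2.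
Proof.
move=> lt; have [/injectiveP ic|/injectivePn[u [v uv cuv]]] := boolP (injectiveb c).
  by rewrite mono_edges_injective.
have ker := kernel_pair uv cuv lt.
rewrite (@sum_mono_edges [:: (u, v); (v, u)]); first last.
- by move=> x y xy; apply: ker; [apply: mono_neq|apply: mono_eq].
- by rewrite /= !inE xpair_eqE (negbTE uv).
by rewrite !big_cons big_nil /= (mono_sym v); case: mono.
Qed.

(** The coincidences form nothing, one pair, one triple or two disjoint pairs. Hence (m, t) is (0,
    0), (2, 0), (4, 0) or (6, 6), and 24 - 18 m + 3 m^2 - 4 t vanishes at the last three. *)
Lemma mono_edges_second_order : #|V| < #|c @: V| + 3 ->
  24 * (mono_edges == 0) + 18 * mono_edges + 4 * mono_triangles =
  24 + 3 * mono_edges ^ 2.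
Proof.
move=> lt; have [/injectiveP ic|/injectivePn[u [v uv cuv]]] := boolP (injectiveb c).
  by rewrite mono_edges_injective ?mono_triangles_injective.
have vu : v != u by rewrite eq_sym.
(* First case: a third vertex shares the colour of u and v. *)
have [/existsP[s /and3P[su sv /eqP csu]]|nots] :=
    boolP [exists s, [&& s != u, s != v & c s == c u]].
  have ker := kernel_triple uv su sv cuv csu lt.
  have us : u != s by rewrite eq_sym.
  have vs : v != s by rewrite eq_sym.
  have inl x y : mono x y -> (x \in [:: u; v; s]) && (y \in [:: u; v; s]).
    by move=> xy; apply: ker; [apply: mono_neq|apply: mono_eq].
  rewrite (@sum_mono_edges [:: (u, v); (v, u); (u, s); (s, u); (v, s); (s, v)]);
    first last.
  - move=> x y xy; have := mono_neq xy; have /andP[] := inl _ _ xy.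
    by rewrite !inE !xpair_eqE => /or3P[]/eqP-> /or3P[]/eqP->; rewrite ?eqxx ?orbT.
  - by rewrite /= !inE !xpair_eqE ?eqxx ?(negbTE uv) ?(negbTE vu) ?(negbTE us)
      ?(negbTE su) ?(negbTE vs) ?(negbTE sv) ?andbF.
  rewrite (@sum_mono_triangles [:: (u, v, s); (u, s, v); (v, u, s); (v, s, u);
    (s, u, v); (s, v, u)]); first last.
  - move=> x y z xy xz yz; have := mono_neq xy; have := mono_neq xz; have := mono_neq yz.
    have /andP[] := inl _ _ xy; have /andP[_] := inl _ _ xz.
    by rewrite !inE !xpair_eqE => /or3P[]/eqP-> /or3P[]/eqP-> /or3P[]/eqP->;
      rewrite ?eqxx ?orbT.
  - by rewrite /= !inE !xpair_eqE ?eqxx ?(negbTE uv) ?(negbTE vu) ?(negbTE us)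
      ?(negbTE su) ?(negbTE vs) ?(negbTE sv) ?andbF.
  rewrite !big_cons !big_nil /= (mono_sym v u) (mono_sym s u) (mono_sym s v).
  by case: (mono u v); case: (mono u s); case: (mono v s).
have nos s : s != u -> s != v -> c s != c u.
  by move=> su sv; apply: contra nots => csu; apply/existsP; exists s; rewrite su sv.
(* Second case: another pair coincides, in a different colour. Otherwise u, v is the only possible
   monochromatic edge. *)
have [/existsP[s /existsP[t /and4P[su sv st /eqP cst]]]|nost] :=
    boolP [exists s, exists t, [&& s != u, s != v, s != t & c s == c t]].
  have ker := kernel_two_pairs uv st cuv cst (nos s su sv) lt.
  have tu : t != u by apply: contraNneq (nos s su sv) => tu; rewrite cst tu.
  have tv : t != v by apply: contraNneq (nos s su sv) => tv; rewrite cst tv cuv.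
  have ker' x y : mono x y -> (x, y) \in [:: (u, v); (v, u); (s, t); (t, s)].
    by move=> xy; apply: ker; [apply: mono_neq|apply: mono_eq].
  have -> : mono_triangles = 0.
    rewrite (@sum_mono_triangles [::]) ?big_nil // => x y z xy xz yz.
    have := ker' _ _ xy; have := ker' _ _ xz; have := mono_neq yz.
    rewrite !inE !xpair_eqE => nyz.
    by case/or4P=> /andP[/eqP ex /eqP ez] /or4P[]/andP[/eqP ex' /eqP ey]; subst;
      move: nyz uv su sv st tu tv; rewrite ?eqxx.
  rewrite (@sum_mono_edges [:: (u, v); (v, u); (s, t); (t, s)]) //; last first.
    by rewrite /= !inE !xpair_eqE ?eqxx (negbTE uv) (negbTE st) !(eq_sym u) !(eq_sym v)
      (negbTE su) (negbTE sv) (negbTE tu) (negbTE tv).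
  rewrite !big_cons !big_nil /= (mono_sym v u) (mono_sym t s).
  by case: (mono u v); case: (mono s t).
have ker x y : mono x y -> (x, y) \in [:: (u, v); (v, u)].
  have inl a b : mono a b -> (a == u) || (a == v).
    move=> ab; apply: contraR nost; rewrite negb_or => /andP[au av].
    apply/existsP; exists a; apply/existsP; exists b.
    by rewrite au av (mono_neq ab) (mono_eq ab) /=.
  move=> xy; have := mono_neq xy; have := inl _ _ xy.
  move: xy; rewrite mono_sym => /inl.
  by rewrite !inE !xpair_eqE => /orP[]/eqP-> /orP[]/eqP->; rewrite ?eqxx ?orbT.
have -> : mono_triangles = 0.
  rewrite (@sum_mono_triangles [::]) ?big_nil // => x y z xy xz yz.
  have := ker _ _ xy; have := ker _ _ xz; have := mono_neq yz.
  rewrite !inE !xpair_eqE => nyz.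
  by case/orP=> /andP[/eqP ex /eqP ez] /orP[]/andP[/eqP ex' /eqP ey]; subst;
    move: nyz uv; rewrite ?eqxx.
rewrite (@sum_mono_edges [:: (u, v); (v, u)]) //; last first.
  by rewrite /= !inE xpair_eqE (negbTE uv).
by rewrite !big_cons big_nil /= (mono_sym v u); case: (mono u v).
Qed.

(* A pair of ordered edges is a matching, or shares an end in one of four ways;
   two edges on the same pair of vertices share both. *)
Lemma mono_edges_sqr :
  mono_edges ^ 2 = 2 * mono_edges + 4 * mono_paths + mono_matchings.
Proof.
have sp (F G : V -> V -> nat) : \sum_s \sum_t (F s t + G s t) =
    \sum_s \sum_t F s t + \sum_s \sum_t G s t.
  by rewrite -big_split; apply: eq_bigr => s _; rewrite big_split.
(* The diagonal v = w contributes the edges, the rest the paths. *)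
have deg : \sum_u \sum_v \sum_w mono u v * mono u w = mono_paths + mono_edges.
  rewrite -big_split; apply: eq_bigr => u _; rewrite -big_split /=.
  apply: eq_bigr => v _; rewrite (bigD1 v) //= [X in _ = X + _](bigD1 v) //=.
  rewrite eqxx !andbF add0n addnC mulnb andbb; congr (_ + _).
  by apply: eq_bigr => w wv; rewrite eq_sym wv andbT mulnb.
(* Edges (s, t) are sorted by the ends they share with a fixed edge uv. The copies (u, v) and (v, u)
   share two ends and are counted twice on the right, hence the correction 2 on the left. *)
have key u v : mono u v -> mono_edges + 2 * mono u v =
    \sum_s \sum_t [&& mono s t, s \notin [:: u; v] & t \notin [:: u; v]]
    + 2 * \sum_w mono u w + 2 * \sum_w mono v w.
  move=> uv.
  have E s t : mono s t + (s == u) * (t == v) * mono s t + (s == v) * (t == u) * mono s t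
     = [&& mono s t, s \notin [:: u; v] & t \notin [:: u; v]]
     + (s == u) * mono s t + (t == u) * mono s t
     + (s == v) * mono s t + (t == v) * mono s t.
    have [st|] := boolP (mono s t); last by rewrite !muln0.
    have n1 z : ~~ ((z == u) && (z == v)).
      by apply/negP => /andP[/eqP-> /eqP euv]; have := mono_neq uv; rewrite -euv eqxx.
    have n2 z : ~~ ((s == z) && (t == z)).
      by apply/negP => /andP[/eqP es /eqP et]; have := mono_neq st; rewrite es et eqxx.
    have := (n1 s, n1 t, n2 u, n2 v); rewrite !inE.
    by case: (s == u); case: (s == v); case: (t == u); case: (t == v) => -[[[]]].
  have D1 (a : V) (F : V -> V -> nat) : \sum_s \sum_t (s == a) * F s t = \sum_t F a t.
    rewrite (bigD1 a) //= [X in _ + X]big1 ?addn0 => [|s sa].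
      by apply: eq_bigr => t _; rewrite eqxx mul1n.
    by rewrite big1 // => t _; rewrite (negbTE sa).
  have D2 (a : V) : \sum_s \sum_t (t == a) * mono s t = \sum_t mono a t.
    rewrite exchange_big -(D1 a (fun s t => mono s t)); apply: eq_bigr => s _.
    by apply: eq_bigr => t _; rewrite mono_sym.
  have D3 (a b : V) : \sum_s \sum_t (s == a) * (t == b) * mono s t = mono a b.
    transitivity (\sum_s \sum_t (s == a) * ((t == b) * mono s t)).
      by apply: eq_bigr => s _; apply: eq_bigr => t _; rewrite mulnA.
    rewrite (D1 a) (bigD1 b) //= eqxx mul1n big1 ?addn0 // => t tb.
    by rewrite (negbTE tb).
  have : \sum_s \sum_t (mono s t + (s == u) * (t == v) * mono s t
      + (s == v) * (t == u) * mono s t) =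
    \sum_s \sum_t ([&& mono s t, s \notin [:: u; v] & t \notin [:: u; v]]
     + (s == u) * mono s t + (t == u) * mono s t
     + (s == v) * mono s t + (t == v) * mono s t).
    by apply: eq_bigr => s _; apply: eq_bigr => t _; apply: E.
  rewrite !sp !D3 !D2 !(D1 _ (fun s t => mono s t)) -/mono_edges (mono_sym v u) => H.
  by move: H; lia.
(* [key] is now summed over all monochromatic edges uv; each of the two sums over w contributes
   twice the paths plus edges. *)
have : \sum_u \sum_v mono u v * (mono_edges + 2 * mono u v) =
    \sum_u \sum_v mono u v *
     (\sum_s \sum_t [&& mono s t, s \notin [:: u; v] & t \notin [:: u; v]]
    + 2 * \sum_w mono u w + 2 * \sum_w mono v w).
  apply: eq_bigr => u _; apply: eq_bigr => v _.
  by have := key u v; case: (mono u v) => [->|_] //; rewrite !mul0n.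
have path1 : \sum_u \sum_v mono u v * (2 * \sum_w mono u w) =
    2 * (mono_paths + mono_edges).
  rewrite -deg [RHS]big_distrr; apply: eq_bigr => u _; rewrite [RHS]big_distrr.
  by apply: eq_bigr => v _ /=; rewrite mulnCA; congr (2 * _); rewrite big_distrr.
have path2 : \sum_u \sum_v mono u v * (2 * \sum_w mono v w) =
    2 * (mono_paths + mono_edges).
  rewrite exchange_big -path1; apply: eq_bigr => u _; apply: eq_bigr => v _.
  by rewrite mono_sym.
under eq_bigr => u _ do under eq_bigr => v _ do rewrite mulnDr.
under [RHS]eq_bigr => u _ do under eq_bigr => v _ do rewrite 2!mulnDr.
rewrite !sp path1 path2.
have -> : \sum_u \sum_v mono u v * mono_edges = mono_edges ^ 2.
  by rewrite -mulnn {2}/mono_edges big_distrl; apply: eq_bigr => u _; rewrite big_distrl.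
have -> : \sum_u \sum_v mono u v * (2 * mono u v) = 2 * mono_edges.
  rewrite [RHS]big_distrr; apply: eq_bigr => u _; rewrite [RHS]big_distrr.
  by apply: eq_bigr => v _ /=; rewrite mulnCA mulnb andbb.
have -> : \sum_u \sum_v mono u v *
    (\sum_s \sum_t [&& mono s t, s \notin [:: u; v] & t \notin [:: u; v]]) =
    mono_matchings.
  apply: eq_bigr => u _; apply: eq_bigr => v _; rewrite big_distrr.
  apply: eq_bigr => s _; rewrite big_distrr; apply: eq_bigr => t _.
  exact: mulnb.
by lia.
Qed.

End Statistics.

(** * Sums of these statistics over permitted colourings *)

Section PermittedSums.
Variables (V : finType) (adj : rel V) (k : nat) (r : restraint V) (x : nat).
Hypotheses (adj_irr : irreflexive adj) (kr : is_k_restraint k r).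
Hypotheses (xge : k * #|V| <= x) (x3k : 3 * k <= x).

Let n := #|V|.

Lemma card_union2 u v :
  #|` (r u `|` r v)%fset| + #|` (r u `&` r v)%fset| = 2 * k.
Proof. by rewrite cardfsUI !(proj1 (kr _)) mul2n addnn. Qed.

Lemma adj_neq u v : adj u v -> u != v.
Proof. by apply: contraTneq => ->; rewrite adj_irr. Qed.

(** An edge uv leaves x - |r u cup r v| = (x - 2k) + |r u cap r v| common colours; only the last
    term depends on the restraint. *)
Lemma sum_permitted_mono_edges :
  \sum_(c : {ffun V -> 'I_x} | permitted r c) mono_edges adj c =
  (\sum_u \sum_v adj u v) * ((x - 2 * k) * (x - k) ^ (n - 2)) +
  (\sum_u \sum_v adj u v * #|` (r u `&` r v)%fset|) * (x - k) ^ (n - 2).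
Proof.
rewrite exchange_big !big_distrl -big_split; apply: eq_bigr => u _ /=.
rewrite exchange_big !big_distrl -big_split; apply: eq_bigr => v _ /=.
rewrite sum_andb_card -mulnA -mulnDr.
have [uv|_] := boolP (adj u v); last by rewrite !mul0n.
rewrite !mul1n (card_permitted_pair kr xge (adj_neq uv)) -mulnDl; congr (_ * _).
by apply: subn_split (card_union2 u v) _; lia.
Qed.

Hypothesis pr : proper_restraint adj r.

Lemma card_union_adj u v : adj u v -> #|` (r u `|` r v)%fset| = 2 * k.
Proof. by move/pr=> uv; have := card_union2 u v; rewrite uv cardfs0 addn0. Qed.

(** Properness makes r u disjoint from r v and r w, so only the two ends can overlap. *)
Lemma card_union_path u v w : adj u v -> adj u w ->
  #|` (r u `|` (r v `|` r w))%fset| + #|` (r v `&` r w)%fset| = 3 * k.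
Proof.
move=> uv uw; have := cardfsUI (r u) (r v `|` r w)%fset.
rewrite fsetIUr (pr uv) (pr uw) fsetU0 cardfs0 (proj1 (kr u)).
by have := card_union2 v w; lia.
Qed.

(** The three forbidden sets on a triangle are pairwise disjoint, so the sum is the same for all
    proper k-restraints. *)
Lemma sum_permitted_mono_triangles :
  \sum_(c : {ffun V -> 'I_x} | permitted r c) mono_triangles adj c =
  (\sum_u \sum_v \sum_w [&& adj u v, adj u w & adj v w]) *
    ((x - 3 * k) * (x - k) ^ (n - 3)).
Proof.
rewrite exchange_big !big_distrl; apply: eq_bigr => u _ /=.
rewrite exchange_big !big_distrl; apply: eq_bigr => v _ /=.
rewrite exchange_big !big_distrl; apply: eq_bigr => w _ /=.
rewrite (eq_bigr (fun c : {ffun V -> 'I_x} =>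
    nat_of_bool ([&& adj u v, adj u w & adj v w] &&
      ((c u == c v) && (c u == c w))))); last first.
  (* Two of the three colour equalities on a triangle imply the third. *)
  move=> c _; rewrite /mono; congr nat_of_bool.
  case: (adj u v) => //; case: (adj u w); case: (adj v w); rewrite ?andbF //=.
  by case: eqVneq => //= ->; rewrite andbb.
rewrite sum_andb_card.
have [/and3P[uv uw vw]|_] := boolP [&& _, _ & _]; last by rewrite !mul0n.
rewrite (card_permitted_triple kr xge) ?adj_neq //; congr (_ * (_ * _)).
by have := card_union_path uv uw; rewrite (pr vw) cardfs0 addn0 => ->.
Qed.

(** The overlap of the forbidden sets at the two ends of a path enlarges the choice of common
    colour; summed over paths, the overlaps are [common_sum]. *)
Lemma sum_permitted_mono_paths :
  \sum_(c : {ffun V -> 'I_x} | permitted r c) mono_paths adj c =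
  (\sum_u \sum_v \sum_w [&& adj u v, adj u w & v != w]) *
    ((x - 3 * k) * (x - k) ^ (n - 3)) + common_sum adj r * (x - k) ^ (n - 3).
Proof.
rewrite exchange_big !big_distrl -big_split; apply: eq_bigr => u _ /=.
rewrite [X in _ + X * _]big_mkcond.
rewrite exchange_big !big_distrl -big_split; apply: eq_bigr => v _ /=.
have -> : (if v \in nbhd adj u then
    \sum_(w in nbhd adj u | v != w) #|` (r v `&` r w)%fset| else 0) =
    \sum_w [&& adj u v, adj u w & v != w] * #|` (r v `&` r w)%fset|.
  rewrite inE; case: ifP => _; last by rewrite big1.
  rewrite big_mkcond; apply: eq_bigr => w _; rewrite inE /=.
  by case: andb; rewrite ?mul1n ?mul0n.
rewrite exchange_big !big_distrl -big_split; apply: eq_bigr => w _ /=.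
rewrite (eq_bigr (fun c : {ffun V -> 'I_x} =>
    nat_of_bool ([&& adj u v, adj u w & v != w] &&
      ((c u == c v) && (c u == c w))))); last first.
  move=> c _; rewrite /mono; congr nat_of_bool.
  by case: (adj u v) => //; case: (adj u w); case: (v != w); rewrite ?andbF ?andbT.
rewrite sum_andb_card.
have [/and3P[uv uw vw]|_] := boolP [&& _, _ & _]; last by rewrite !mul0n.
rewrite !mul1n -mulnDl.
rewrite (card_permitted_triple kr xge (adj_neq uv) (adj_neq uw) vw); congr (_ * _).
exact: subn_split (card_union_path uv uw) x3k.
Qed.

Lemma sum_permitted_mono_matchings :
  \sum_(c : {ffun V -> 'I_x} | permitted r c) mono_matchings adj c =
  (\sum_u \sum_v \sum_s \sum_t
     [&& adj u v, adj s t, s \notin [:: u; v] & t \notin [:: u; v]]) *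
    ((x - 2 * k) * (x - 2 * k) * (x - k) ^ (n - 4)).
Proof.
rewrite exchange_big !big_distrl; apply: eq_bigr => u _ /=.
rewrite exchange_big !big_distrl; apply: eq_bigr => v _ /=.
rewrite exchange_big !big_distrl; apply: eq_bigr => s _ /=.
rewrite exchange_big !big_distrl; apply: eq_bigr => t _ /=.
rewrite (eq_bigr (fun c : {ffun V -> 'I_x} => nat_of_bool ([&& adj u v, adj s t,
   s \notin [:: u; v] & t \notin [:: u; v]] && ((c u == c v) && (c s == c t))))); last first.
  move=> c _; rewrite /mono; congr nat_of_bool.
  by case: (adj u v) => //; case: (adj s t); rewrite ?andbF //= andbA andbC.
rewrite sum_andb_card.
have [/and4P[uv st su tu]|_] := boolP [&& _, _, _ & _]; last by rewrite !mul0n.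
rewrite (card_permitted_two_pairs kr xge (adj_neq uv) (adj_neq st) su tu).
by rewrite !card_union_adj.
Qed.

End PermittedSums.

(** * Properness of maximal restraints and extremality of [common_sum] *)

Section Main.
Variables (V : finType) (adj : rel V) (k : nat).
Hypotheses (adj_sym : symmetric adj) (adj_irr : irreflexive adj).

(** Consecutive blocks of k colours, starting at 1, in the order of the vertices: a proper
    competitor on every graph. *)
Definition disjoint_restraint : restraint V :=
  fun v => [fset a in iota (k * enum_rank v).+1 k]%fset.

Lemma disjoint_restraint_k : is_k_restraint k disjoint_restraint.
Proof.
move=> v; split; first by rewrite card_fseq undup_id ?iota_uniq // size_iota.
move=> a; rewrite inE mem_iota => /andP[a1 a2].
have : k * (enum_rank v).+1 <= k * #|V| by rewrite leq_mul2l ltn_ord orbT.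
by move: a1 a2; rewrite mulnS; lia.
Qed.

Lemma disjoint_restraint_proper : proper_restraint adj disjoint_restraint.
Proof.
move=> u v uv; apply/fsetP => a; rewrite !inE !mem_iota.
have : (enum_rank u : nat) != enum_rank v.
  by rewrite (inj_eq val_inj) (inj_eq enum_rank_inj); apply: adj_neq uv.
by move=> ne; apply/negP => /andP[/andP[a1 a2] /andP[a3 a4]]; nia.
Qed.

Lemma common_sum_A7 (r : restraint V) :
  ((common_sum adj r)%:Z = - A7'' adj r - A7'' adj r)%R.
Proof.
rewrite /A7'' opprK /common_sum.
have -> : (\sum_(u : V) \sum_(v in nbhd adj u)
      \sum_(w in nbhd adj u | (enum_rank v < enum_rank w)%N)
        (#|` (r v `&` r w)%fset|)%:Z)%R =
  (\sum_(u : V) \sum_(v in nbhd adj u)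
      \sum_(w in nbhd adj u | (enum_rank v < enum_rank w)%N)
        #|` (r v `&` r w)%fset|)%N%:Z%R.
  rewrite -sum_Posz; apply: eq_bigr => u _; rewrite -sum_Posz.
  by apply: eq_bigr => v _; rewrite sum_Posz.
rewrite -PoszD; congr Posz; rewrite -big_split; apply: eq_bigr => u _ /=.
(* Exchanging v and w in the second copy turns it into the pairs with v after w. *)
rewrite [X in _ = _ + X](exchange_big_dep (fun v => v \in nbhd adj u)) /=;
  last by move=> v w _ /andP[].
rewrite -big_split; apply: eq_bigr => v vu /=.
rewrite (bigID (fun w => (enum_rank v < enum_rank w))) /=; congr (_ + _).
  apply: eq_bigl => w; rewrite -andbA; congr (_ && _).
  by case: eqVneq => [->|//]; rewrite ltnn.
rewrite (eq_bigr (fun w => #|` (r w `&` r v)%fset|)) => [|w _]; last by rewrite fsetIC.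
apply: eq_bigl => w; rewrite vu /= -andbA; congr (_ && _).
by rewrite -leqNgt ltn_neqAle (inj_eq val_inj) (inj_eq enum_rank_inj) eq_sym.
Qed.

(** A nonzero term needs three distinct vertices. This settles the graphs too small for a comparison
    at order n - 3. *)
Lemma common_sum_small (r : restraint V) : #|V| < 3 -> common_sum adj r = 0.
Proof.
move=> V3; rewrite /common_sum big1 // => u _; rewrite big1 // => v uv.
rewrite big1 // => w /andP[uw vw]; move: uv uw; rewrite !inE => uv uw.
have := max_card (mem (u |: [set v; w])).
rewrite cardsU1 cards2 vw !inE negb_or (adj_neq adj_irr uv) (adj_neq adj_irr uw).
by move=> le; have := leq_trans le V3.
Qed.

Lemma sum_permitted_const (r : restraint V) (x a : nat) :
  is_k_restraint k r -> k * #|V| <= x ->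
  (\sum_(c : {ffun V -> 'I_x} | permitted r c) a%:Z = (a * (x - k) ^ #|V|)%N%:Z)%R.
Proof.
move=> kr xge; rewrite sum_Posz -(card_permitted kr xge) mulnC -sum_nat_const.
by congr Posz; apply: eq_bigl => c; rewrite inE.
Qed.

Lemma sum_adj_inter0 (s : restraint V) : proper_restraint adj s ->
  \sum_u \sum_v adj u v * #|` (s u `&` s v)%fset| = 0.
Proof.
move=> ps; rewrite big1 // => u _; rewrite big1 // => v _.
by have [uv|//] := boolP (adj u v); rewrite (ps _ _ uv) cardfs0.
Qed.

(** Against [disjoint_restraint], the overlaps of r along edges add monochromatic edges and so lower
    the sum of g by K (x - k)^(n - 2); maximality forces K = 0. *)
Lemma Rmax_proper (r : restraint V) : Rmax adj k r -> proper_restraint adj r.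
Proof.
move=> [kr rmax] u v uv; apply/eqP; rewrite -cardfs_eq0; apply/eqP.
have [x0 cnt] := rmax _ disjoint_restraint_k.
pose K := \sum_a \sum_b adj a b * #|` (r a `&` r b)%fset|.
suff K0 : K = 0.
  move/eqP: K0; rewrite sum_nat_eq0 => /forallP/(_ u)/=.
  by rewrite sum_nat_eq0 => /forallP/(_ v)/=; rewrite uv mul1n => /eqP.
pose g x (c : {ffun V -> 'I_x}) : int := (2%:Z - (mono_edges adj c)%:Z)%R.
apply: (@leading_term_le V adj k disjoint_restraint r 2 2 K (4 + #|V| ^ 2) x0
  (k * #|V| + 3 * k) g) => //.
- exact: disjoint_restraint_k.
- have := max_card (mem [set u; v]).
  by rewrite cards2 (adj_neq adj_irr uv).
- move=> x c; have := mono_edges_le adj c; rewrite /g.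
  by case: proper_colouring; lia.
- move=> x c lt; have := mono_edges_first_order adj_sym adj_irr lt.
  by rewrite mono_edges_eq0 -/(proper_colouring adj c) /g; lia.
move=> x xge.
have xV : k * #|V| <= x by lia.
have x3 : 3 * k <= x by lia.
rewrite /g !sumrB !sum_permitted_const //; last exact: disjoint_restraint_k.
rewrite !sum_Posz !(@sum_permitted_mono_edges _ _ k) //; last exact: disjoint_restraint_k.
rewrite -/K (sum_adj_inter0 disjoint_restraint_proper).
by rewrite mul0n addn0 PoszD; ring.
Qed.

(** Both restraints are proper, so the terms of order n - 2 agree. A larger [common_sum] for r would
    give it more colourings at order n - 3. *)
Lemma Rmax_common_sum (r r' : restraint V) : Rmax adj k r' ->
  is_k_restraint k r -> proper_restraint adj r ->
  common_sum adj r <= common_sum adj r'.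
Proof.
move=> max' kr pr; have pr' := Rmax_proper max'; have [kr' rmax] := max'.
have [V3|V3] := ltnP #|V| 3; first by rewrite common_sum_small.
have [//|lt] := leqP; have [x0 cnt] := rmax _ kr.
pose g x (c : {ffun V -> 'I_x}) : int :=
  (24%:Z + 12%:Z * (mono_paths adj c)%:Z + 3%:Z * (mono_matchings adj c)%:Z
   - 12%:Z * (mono_edges adj c)%:Z - 4%:Z * (mono_triangles adj c)%:Z)%R.
(* Expanding 3 m^2 by [mono_edges_sqr] adds 6 m to -18 m and produces 12 times the paths, the source
   of the factor 12 in K. *)
have gE x (c : {ffun V -> 'I_x}) : g x c = (24%:Z + (3 * mono_edges adj c ^ 2)%N%:Z
    - 18%:Z * (mono_edges adj c)%:Z - 4%:Z * (mono_triangles adj c)%:Z)%R.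
  by rewrite /g mono_edges_sqr //; lia.
pose K := 12 * (common_sum adj r - common_sum adj r').
suff : K = 0 by rewrite /K; lia.
apply: (@leading_term_le V adj k r r' 3 24 K
  (48 + 3 * (#|V| ^ 2) ^ 2 + 18 * #|V| ^ 2 + 4 * #|V| ^ 3) x0
  (k * #|V| + 3 * k) g) => //.
- move=> x c; rewrite gE; have le1 := mono_edges_le adj c.
  have le2 := mono_triangles_le adj c.
  have : mono_edges adj c ^ 2 <= (#|V| ^ 2) ^ 2 by rewrite leq_exp2r.
  by move: le1 le2; case: proper_colouring; lia.
- move=> x c lt3; rewrite gE.
  have := mono_edges_second_order adj_sym adj_irr lt3.
  by rewrite mono_edges_eq0 -/(proper_colouring adj c); lia.
move=> x xge.
have xV : k * #|V| <= x by lia.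
have x3 : 3 * k <= x by lia.
have gsum s : is_k_restraint k s -> proper_restraint adj s ->
  (\sum_(c | permitted s c) g x c = 24%:Z * ((x - k) ^ #|V|)%N%:Z
    + 12%:Z * (\sum_(c : {ffun V -> 'I_x} | permitted s c) mono_paths adj c)%N%:Z
    + 3%:Z * (\sum_(c : {ffun V -> 'I_x} | permitted s c) mono_matchings adj c)%N%:Z
    - 12%:Z * (\sum_(c : {ffun V -> 'I_x} | permitted s c) mono_edges adj c)%N%:Z
    - 4%:Z * (\sum_(c : {ffun V -> 'I_x} | permitted s c) mono_triangles adj c)%N%:Z)%R.
  move=> ks ps; rewrite /g !sumrB !big_split /= sum_permitted_const //.
  by rewrite -!mulr_sumr !sum_Posz PoszM.
rewrite !gsum // !(@sum_permitted_mono_paths _ _ k) //.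
rewrite !(@sum_permitted_mono_matchings _ _ k) //.
rewrite !(@sum_permitted_mono_edges _ _ k) // !(@sum_permitted_mono_triangles _ _ k) //.
(* The edge overlaps vanish by properness, so the two sides differ only through [common_sum]. *)
rewrite !sum_adj_inter0 // /K mul0n addn0 !PoszD.
rewrite -{1}(subnK (ltnW lt)) mulnDl PoszD -mulnA PoszM.
by ring.
Qed.

End Main.

Theorem theorem4p5 (V : finType) (adj : rel V)
    (adj_sym : symmetric adj) (adj_irr : irreflexive adj)
    (k : nat) (k_gt0 : (0 < k)%N) (rstar : restraint V)
    (rstar_max : Rmax adj k rstar) :
  [/\ proper_restraint adj rstar,
      is_minimum
        (fun z : int => exists r : restraint V,
           [/\ is_k_restraint k r, proper_restraint adj r & z = A7'' adj r])
        (A7'' adj rstar)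
    & forall r : restraint V, is_k_restraint k r -> proper_restraint adj r ->
        (common_sum adj r <= common_sum adj rstar)%N].
Proof.
have pstar := Rmax_proper adj_sym adj_irr rstar_max.
have le := Rmax_common_sum adj_sym adj_irr rstar_max.
split=> //; split; first by exists rstar; split=> //; case: rstar_max.
(* As [common_sum] equals -2 times [A7''], maximising the former minimises the latter. *)
move=> _ [r [kr pr ->]]; have := le r kr pr; rewrite -lez_nat !common_sum_A7.
by lia.
Qed.
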